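(* Let $p$ be a prime and $1\le i\le p$. Then $$N_{S_{p^2}}(P_i')=\begin{cases}\mathrm{AGL}(2,p) & \text{if } i=1,\\ P_{i+1}'\rtimes\langle\bar\beta,\tilde\beta:\beta\in\mathbb{F}_p^*\rangle & \text{if } 2\le i\le p-1,\\ P_p'\rtimes\langle\bar\beta,\tilde\beta:\beta\in\mathbb{F}_p^*\rangle & \text{if } i=p.\end{cases}$$
   Context: $S_{p^2}$ acts on $\mathbb{Z}_p\times\mathbb{Z}_p=\mathbb{F}_p^2$. Let $\rho_1(i,j)=(i,j+1)$, $\rho_2(i,j)=(i+1,j)$, and, for $0\le k\le p-1$, let $z_k$ map $(k,b)$ to $(k,b+1)$ and fix all $(a,b)$ with $a\neq k$. Put $a_{m,k}=\binom{m}{k}(-1)^{m-k}$ and, for $1\le i\le p$, $\gamma_i=\prod_{k=0}^{p-1}z_k^{a_{p-i,k}}$ and $P_i'=\langle\rho_1,\rho_2,\gamma_i\rangle$. For $\beta\in\mathbb{F}_p^*$, $\bar\beta(i,j)=(\beta i,j)$ and $\tilde\beta(i,j)=(i,\beta j)$. $\mathrm{AGL}(2,p)$ is the group of affine transformations of $\mathbb{F}_p^2$. *)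

(* Defs.v *)
From HB Require Import structures.
From mathcomp Require Import all_boot all_order all_algebra all_fingroup.

Set Implicit Arguments.
Unset Strict Implicit.
Unset Printing Implicit Defensive.

Import GRing.Theory.
Local Open Scope ring_scope.

(* Below p is a bare nat; 'F_p is the field with p elements only when p is
   prime. *)

Definition point (p : nat) : finType := ('F_p * 'F_p)%type.

Section Perms.

Variable p : nat.
Implicit Types (x : point p) (k : 'F_p) (b : {unit 'F_p}).

Definition rho1_fun x : point p := (x.1, x.2 + 1).
Definition rho2_fun x : point p := (x.1 + 1, x.2).
Definition z_fun k x : point p := if x.1 == k then (x.1, x.2 + 1) else x.
Definition bar_fun b x : point p := (val b * x.1, x.2).
Definition tilde_fun b x : point p := (x.1, val b * x.2).

Lemma rho1_inj : injective rho1_fun.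
Proof. by case=> x y [x' y'] /pair_equal_spec[/= -> /addIr->]. Qed.

Lemma rho2_inj : injective rho2_fun.
Proof. by case=> x y [x' y'] /pair_equal_spec[/= /addIr-> ->]. Qed.

Lemma z_inj k : injective (z_fun k).
Proof.
case=> x y [x' y']; rewrite /z_fun /=.
case: ifP => hx; case: ifP => hx' /pair_equal_spec[/= ex].
- by move=> /addIr->; rewrite ex.
- by rewrite -ex hx in hx'.
- by rewrite ex hx' in hx.
- by move=> ->; rewrite ex.
Qed.

Lemma bar_inj b : injective (bar_fun b).
Proof. by case=> x y [x' y'] /pair_equal_spec[/= /(mulrI (valP b))-> ->]. Qed.

Lemma tilde_inj b : injective (tilde_fun b).
Proof. by case=> x y [x' y'] /pair_equal_spec[/= -> /(mulrI (valP b))->]. Qed.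

Definition rho1 : {perm point p} := perm rho1_inj.
Definition rho2 : {perm point p} := perm rho2_inj.
Definition z k : {perm point p} := perm (@z_inj k).
Definition bar b : {perm point p} := perm (@bar_inj b).
Definition tilde b : {perm point p} := perm (@tilde_inj b).

End Perms.

Definition expgz (gT : finGroupType) (x : gT) (n : int) : gT :=
  match n with
  | Posz m => (x ^+ m)%g
  | Negz m => (x ^- m.+1)%g
  end.

(* The truncated subtraction is harmless: 'C(m, k) = 0 when m < k. *)
Definition acoef (m k : nat) : int := 'C(m, k)%:Z * (-1) ^+ (m - k).

Definition gamma (p i : nat) : {perm point p} :=
  (\prod_(0 <= k < p) expgz (z (k%:R : 'F_p)) (acoef (p - i) k))%g.

Definition P' (p i : nat) : {set {perm point p}} :=
  <<[set rho1 p; rho2 p; gamma p i]>>%g.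
Canonical P'_group (p i : nat) : {group {perm point p}} :=
  Eval hnf in [group of P' p i].

Definition dilations (p : nat) : {set {perm point p}} :=
  <<[set bar b | b : {unit 'F_p}] :|: [set tilde b | b : {unit 'F_p}]>>%g.
Canonical dilations_group (p : nat) : {group {perm point p}} :=
  Eval hnf in [group of dilations p].

Definition colv (p : nat) (x : point p) : 'cV['F_p]_2 :=
  \col_(j < 2) (if j == 0 then x.1 else x.2).

Definition AGL2 (p : nat) : {set {perm point p}} :=
  [set s : {perm point p} |
    [exists A : {'GL_2['F_p]}, [exists c : 'cV['F_p]_2,
      [forall x : point p, colv (s x) == GLval A *m colv x + c]]]].

(* Main.v *)
(* Functions F_p -> F_p are filtered by the vanishing of iterated differences,
   i.e. by degree.  The exponents of gamma_i are the coefficients of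
   (X - 1)^(p - i); mod p they are a polynomial function of the index, of degree
   exactly i - 1, so that P'_i consists of the maps (x, y) |-> (x + a, y + g x)
   with deg g < i.  For i >= 2 an element s normalizing P'_i permutes its point
   stabilizers; these consist of shears (x, y) |-> (x, y + g x) and are
   transitive on every column they do not fix, hence s permutes the columns.
   Conjugating rho_1 and rho_2 by s forces s (x, y) = (b x + c, a y + h x)
   where the difference of h has degree < i, that is h has degree <= i (no
   condition when i = p).  For i = 1, P'_1 is the translation group, and an s
   normalizing it is affine. *)

Require Import Defs.
From mathcomp Require Import all_boot all_order all_algebra all_fingroup.
From mathcomp Require Import ring.

Set Implicit Arguments.
Unset Strict Implicit.
Unset Printing Implicit Defensive.

Import GRing.Theory.
Local Open Scope ring_scope.

(** * Iterated differences of functions on F_p *)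

Section Differences.

Variable p : nat.
Implicit Types (a b c x : 'F_p) (g h : {ffun 'F_p -> 'F_p}) (n : nat).

Definition Delta g : {ffun 'F_p -> 'F_p} := [ffun x => g (x + 1) - g x].

(* For p prime and n <= p these are the polynomial functions of degree < n. *)
Definition deg_lt n g := iter n Delta g == 0.

(** Every residue is a sum of ones; recurrences in steps of 1, such as those that [rho1] and [rho2]
    produce, are solved this way. *)
Lemma Fp_succ_ind (P : 'F_p -> Prop) :
  P 0 -> (forall x, P x -> P (x + 1)) -> forall x, P x.
Proof.
move=> P0 PS x; rewrite -[x]natr_Zp; elim: (x : nat) => [//|n IHn].
by rewrite -addn1 natrD; apply: PS.
Qed.

Lemma deg_ltS n g : deg_lt n.+1 g = deg_lt n (Delta g).
Proof. by rewrite /deg_lt iterSr. Qed.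

Lemma deg_lt0 n : deg_lt n 0.
Proof.
elim: n => [|n IHn]; first exact: eqxx.
by rewrite deg_ltS; have ->: Delta 0 = 0 by apply/ffunP=> x;
  rewrite !ffunE subrr.
Qed.

Lemma deg_ltD n g h : deg_lt n g -> deg_lt n h -> deg_lt n (g + h).
Proof.
elim: n g h => [|n IHn] g h; first by move=> /eqP /= -> /eqP /= ->;
  rewrite addr0 deg_lt0.
rewrite !deg_ltS => gn hn; rewrite (_ : Delta _ = Delta g + Delta h) ?IHn //.
by apply/ffunP=> x; rewrite !ffunE; ring.
Qed.

Lemma deg_ltZ n a g : deg_lt n g -> deg_lt n [ffun x => a * g x].
Proof.
elim: n g => [|n IHn] g.
  by move=> /eqP /= ->; apply/eqP/ffunP=> x; rewrite !ffunE mulr0.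
rewrite !deg_ltS => /IHn; congr deg_lt.
by apply/ffunP=> x; rewrite !ffunE; ring.
Qed.

Lemma deg_lt_sum n (I : Type) (r : seq I) (G : I -> {ffun 'F_p -> 'F_p}) :
  (forall i, deg_lt n (G i)) -> deg_lt n (\sum_(i <- r) G i).
Proof.
by move=> Gn; elim/big_ind: _ => [|g h|i _]; [apply: deg_lt0|apply: deg_ltD|].
Qed.

Lemma deg_lt_shift n c g : deg_lt n g -> deg_lt n [ffun x => g (x + c)].
Proof.
elim: n g => [|n IHn] g.
  by move=> /eqP /= ->; apply/eqP/ffunP=> x; rewrite !ffunE.
rewrite !deg_ltS => /IHn; congr deg_lt.
by apply/ffunP=> x; rewrite !ffunE addrAC.
Qed.

(** Telescoping: a difference with step [c] is a sum of translates of [Delta g]. *)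
Lemma deg_lt_diff n c g :
  deg_lt n (Delta g) -> deg_lt n [ffun x => g (x + c) - g x].
Proof.
move=> gn; elim/Fp_succ_ind: c => [|c IHc].
  rewrite (_ : finfun _ = 0) ?deg_lt0 //.
  by apply/ffunP=> x; rewrite !ffunE addr0 subrr.
have := deg_ltD IHc (deg_lt_shift c gn); congr deg_lt.
by apply/ffunP=> x; rewrite !ffunE (addrA x c 1); ring.
Qed.

Lemma deg_lt_affine n b c g : deg_lt n g -> deg_lt n [ffun x => g (b * x + c)].
Proof.
elim: n g => [|n IHn] g.
  by move=> /eqP /= ->; apply/eqP/ffunP=> x; rewrite !ffunE.
(* The unit difference of [g (b * x + c)] is the difference of [g] with step [b], taken at
   [b * x + c]. *)
rewrite !deg_ltS => /(deg_lt_diff b)/IHn; congr deg_lt.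
by apply/ffunP=> x; rewrite !ffunE mulrDr mulr1 addrAC.
Qed.

Lemma deg_lt_cst n a : deg_lt n.+1 [ffun _ => a].
Proof.
rewrite deg_ltS (_ : Delta _ = 0) ?deg_lt0 //.
by apply/ffunP=> x; rewrite !ffunE subrr.
Qed.

Lemma Delta_cst g : Delta g = 0 -> forall x, g x = g 0.
Proof.
move=> g0; elim/Fp_succ_ind=> [//|x <-]; apply/eqP; rewrite -subr_eq0.
by have := congr1 (fun h : {ffun _} => h x) g0; rewrite !ffunE => ->.
Qed.

Lemma deg_lt_id n a : deg_lt n.+2 [ffun x => x + a].
Proof.
rewrite deg_ltS; have := deg_lt_cst n 1; congr deg_lt.
by apply/ffunP=> x; rewrite !ffunE; ring.
Qed.

(* The coefficients of (X - 1)^m, indexed by residues mod p. *)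
Definition bincoef m : {ffun 'F_p -> 'F_p} :=
  [ffun x : 'F_p => (acoef m x)%:~R].

(** * Signed binomial coefficients as functions on F_p *)

Hypothesis p_pr : prime p.

Lemma bincoef_nat m k : (k < p)%N ->
  bincoef m k%:R = ('C(m, k))%:R * (-1) ^+ (m - k).
Proof.
move=> ltkp; rewrite ffunE val_Fp_nat // modn_small // /acoef.
by rewrite rmorphM rmorphXn rmorphN1.
Qed.

Lemma Fp_nat x : exists2 k, (k < p)%N & x = k%:R.
Proof.
exists (x : nat); last by rewrite natr_Zp.
by have := ltn_ord x; rewrite [X in (_ < X)%N](Fp_cast p_pr).
Qed.

(** Pascal's rule with signs; [k < m] makes the truncated exponents [m - k] and [m - k.+1] differ by
    exactly one. *)
Lemma bincoef_succ m k : (k < m)%N -> (k.+1 < p)%N ->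
  bincoef m.+1 k.+1%:R = bincoef m k%:R - bincoef m k.+1%:R.
Proof.
move=> ltkm ltkp; rewrite !bincoef_nat ?(ltnW ltkp) // binS natrD.
by rewrite subSS -[(m - k)%N]subnSK // exprS; ring.
Qed.

Lemma bincoef_small m k : (m < k < p)%N -> bincoef m k%:R = 0.
Proof. by case/andP=> ltmk ltkp; rewrite bincoef_nat // bin_small // mul0r. Qed.

Lemma bincoef_diag m : (m < p)%N -> bincoef m m%:R = 1.
Proof. by move=> ltmp; rewrite bincoef_nat // binn subnn mulr1. Qed.

Lemma natr_predp : p.-1%:R = - 1 :> 'F_p.
Proof.
apply/eqP; rewrite -subr_eq0 opprK natr1 prednK ?prime_gt0 //.
by rewrite (pcharf0 (pchar_Fp p_pr)).
Qed.

(** Pascal's rule again. Up to sign and shift, each difference raises [m] by one, until [m = p.-1],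
    where the function is constant. *)
Lemma Delta_bincoef m : (m.+1 < p)%N ->
  Delta (bincoef m) = [ffun x => - bincoef m.+1 (x + 1)].
Proof.
move=> ltmp; apply/ffunP=> x; have [k ltkp ->] := Fp_nat x.
rewrite [LHS]ffunE [RHS]ffunE.
have [ltkp'|lepk] := ltnP k.+1 p; last first.
  (* Wrap-around from [p.-1] to 0: [bincoef m] vanishes at [p.-1] because [m < p.-1], and the values
     at 0 are powers of -1. *)
  have ->: k = p.-1 by apply/eqP;
    rewrite eqn_leq -ltnS prednK ?prime_gt0 // ltkp -ltnS prednK ?prime_gt0.
  rewrite [bincoef m p.-1%:R]bincoef_small ?prednK ?prime_gt0 //; last first.
    by rewrite -ltnS prednK ?prime_gt0 // ltmp /=.
  have := @bincoef_nat m 0 (prime_gt0 p_pr).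
  have := @bincoef_nat m.+1 0 (prime_gt0 p_pr).
  by rewrite natr_predp addNr !bin0 !subn0 exprS => -> ->; ring.
rewrite natr1; have [ltkm|] := ltnP k m; first by rewrite bincoef_succ //; ring.
rewrite leq_eqVlt => /predU1P[<-|ltmk].
  by rewrite !bincoef_diag ?(ltnW ltmp) // bincoef_small ?ltnSn //; ring.
by rewrite !bincoef_small ?ltnS ?ltmk ?ltkp ?(ltnW ltmk) ?(leq_trans ltmk) //;
  ring.
Qed.

(** Since p divides ['C(p, r.+1)], Pascal's rule makes neighbouring entries of row [p.-1] opposite
    mod p, and the signs cancel this. The induction descends from the last entry. *)
Lemma bincoef_predp x : bincoef p.-1 x = 1.
Proof.
have p1 : (p.-1 < p)%N by rewrite ltn_predL prime_gt0.
have [k ltkp ->] := Fp_nat x;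
  have lekp : (k <= p.-1)%N by rewrite -ltnS prednK ?prime_gt0.
rewrite -(subKn lekp); elim: (_ - k)%N (leq_subr k p.-1) => [|j IHj] lejp.
  by rewrite subn0 bincoef_diag.
have eqj: (p.-1 - j = (p.-1 - j.+1).+1)%N by rewrite subnSK.
have ltjp : ((p.-1 - j.+1).+1 < p)%N by rewrite -eqj (leq_ltn_trans (leq_subr _ _)).
have := IHj (ltnW lejp); rewrite eqj; rewrite !bincoef_nat ?(ltnW ltjp) //.
set r := (p.-1 - j.+1)%N in eqj ltjp *.
have ltr : (r < p.-1)%N by rewrite -ltnS prednK ?prime_gt0.
have: ('C(p, r.+1))%:R = 0 :> 'F_p.
  apply/eqP; rewrite -(dvdn_pcharf (pchar_Fp p_pr)).
  by rewrite prime_dvd_bin.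
rewrite -[X in 'C(X, _)](prednK (prime_gt0 p_pr)) binS natrD => /eqP.
rewrite addr_eq0 => /eqP ->; rewrite -[(p.-1 - r)%N]subnSK // exprS.
by rewrite mulN1r mulrN mulNr.
Qed.

Lemma iter_Delta_shiftN n c g :
  iter n Delta [ffun x => - g (x + c)] = [ffun x => - iter n Delta g (x + c)].
Proof.
elim: n => [//|n IHn]; rewrite !iterS IHn.
by apply/ffunP=> x; rewrite !ffunE addrAC; ring.
Qed.

(* The function of [gamma p n.+1] has degree exactly [n]. *)
Lemma iter_Delta_bincoef n : (n < p)%N ->
  exists2 c, c != 0 & iter n Delta (bincoef (p.-1 - n)) = [ffun _ => c].
Proof.
elim: n => [|n IHn] ltnp.
  exists 1; first exact: oner_neq0.
  by apply/ffunP=> x; rewrite subn0 [RHS]ffunE bincoef_predp.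
have [c c0 En] := IHn (ltnW ltnp); exists (- c); first by rewrite oppr_eq0.
have ltn' : (n < p.-1)%N by rewrite -ltnS prednK ?prime_gt0.
have Em : (p.-1 - n = (p.-1 - n.+1).+1)%N by rewrite subnSK.
rewrite iterSr Delta_bincoef -Em; last first.
  by rewrite (leq_ltn_trans (leq_subr _ _)) // ltn_predL prime_gt0.
by rewrite iter_Delta_shiftN En; apply/ffunP=> x; rewrite !ffunE.
Qed.

Lemma deg_lt_bincoef n : (0 < n <= p)%N -> deg_lt n (bincoef (p - n)).
Proof.
case: n => [//|n] /= ltnp; have [c _ En] := iter_Delta_bincoef ltnp.
rewrite /deg_lt iterS -subn1 -subnDA add1n in En *.
by rewrite En; apply/eqP/ffunP=> x; rewrite !ffunE subrr.
Qed.

Lemma bincoef0 x : bincoef 0 x = (x == 0)%:R.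
Proof.
have [->|] := eqVneq; first by rewrite (@bincoef_nat 0 0) ?prime_gt0 // mulr1.
by have [[|k] ltkp -> //] := Fp_nat x; rewrite ?eqxx // bincoef_small.
Qed.

(** Every function is a linear combination of translates of the indicator of 0, which is
    [bincoef 0]. *)
Lemma deg_lt_p g : deg_lt p g.
Proof.
have ->: g = \sum_a [ffun x => g a * [ffun y => bincoef 0 (y + - a)] x].
  apply/ffunP=> x; rewrite sum_ffunE (bigD1 x) //= big1 => [|a a_neq].
    by rewrite addr0 2!ffunE bincoef0 subrr eqxx mulr1.
  by rewrite 2!ffunE bincoef0 subr_eq0 eq_sym (negPf a_neq) mulr0.
apply: deg_lt_sum => a; apply/deg_ltZ/deg_lt_shift.
by have := @deg_lt_bincoef p; rewrite subnn => -> //; rewrite leqnn prime_gt0.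
Qed.

Lemma iter_Delta_linear n a g h :
  iter n Delta (g - [ffun x => a * h x]) =
  iter n Delta g - [ffun x => a * iter n Delta h x].
Proof.
elim: n => [//|n IHn]; rewrite !iterS IHn.
by apply/ffunP=> x; rewrite !ffunE; ring.
Qed.

(* Induction on the degree [n - 1] of [g]: subtract from [g] a multiple of the
   [(i - n)]-th difference of [bincoef (p - i)]. *)
Lemma deg_lt_span (G : {ffun 'F_p -> 'F_p} -> Prop) i :
    (0 < i <= p)%N -> G 0 -> (forall g h, G g -> G h -> G (g + h)) ->
    (forall g, G g -> G (Delta g)) -> G (bincoef (p - i)) ->
  forall g, deg_lt i g -> G g.
Proof.
case: i => [//|i] /= ltip G0 GD GDelta Gf.
(* Scalars of F_p act by repeated addition, so additive closure suffices. *)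
have GZ a g : G g -> G [ffun x => a * g x].
  move=> Gg; rewrite -[a]natr_Zp; elim: (a : nat) => [|n IHn].
    by rewrite (_ : finfun _ = 0) //; apply/ffunP=> x; rewrite !ffunE mul0r.
  have := GD _ _ IHn Gg; congr G; apply/ffunP=> x;
    rewrite !ffunE -[n.+1%:R]natr1.
  by ring.
have [c c0 En] := iter_Delta_bincoef ltip.
rewrite -subn1 -subnDA add1n in En.
suff Gn n : (n <= i.+1)%N -> forall g, deg_lt n g -> G g by exact: Gn.
elim: n => [|n IHn] lein g; first by move=> /eqP /= ->.
rewrite /deg_lt iterS => /eqP /Delta_cst gn.
set f := iter (i - n) Delta (bincoef (p - i.+1)).
have Gf' : G f by rewrite /f; elim: (i - n)%N => //= m; apply: GDelta.
(* The [n]-th differences of [g] and [f] are constants, the latter equal to [c]; this ratio makes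
   them cancel. *)
set a := iter n Delta g 0 / c.
have ->: g = (g - [ffun x => a * f x]) + [ffun x => a * f x] by rewrite subrK.
apply: GD (GZ _ _ Gf'); apply: IHn; first exact: ltnW.
rewrite /deg_lt iter_Delta_linear /f -iterD subnKC // En.
by apply/eqP/ffunP=> x; rewrite !ffunE gn divfK ?subrr.
Qed.

End Differences.

(** * Shears and an explicit form of the groups P'_i *)

Section Groups.

Variable p : nat.
Implicit Types (a b c : 'F_p) (g h : {ffun 'F_p -> 'F_p}) (n i : nat).
Implicit Types (x : point p) (s t : {perm point p}).

Definition shear_fun g x : point p := (x.1, x.2 + g x.1).

Lemma shear_inj g : injective (shear_fun g).
Proof. by case=> u v [u' v'] /pair_equal_spec[/= -> /addIr->]. Qed.

Definition shear g : {perm point p} := perm (@shear_inj g).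

Lemma shearD g h : shear (g + h) = (shear g * shear h)%g.
Proof. by apply/permP=> x; rewrite permM !permE /shear_fun /= ffunE addrA. Qed.

Lemma shear0 : shear 0 = 1%g.
Proof.
by apply/permP=> -[u v]; rewrite !permE /shear_fun /= ffunE addr0.
Qed.

Lemma shearMn g n : shear (g *+ n) = (shear g ^+ n)%g.
Proof.
by elim: n => [|n IHn]; rewrite ?mulr0n ?shear0 // mulrS expgS shearD IHn.
Qed.

Lemma shearN g : shear (- g) = (shear g)^-1%g.
Proof. by apply: (mulgI (shear g)); rewrite -shearD subrr shear0 mulgV. Qed.

Lemma rho1_shear : rho1 p = shear [ffun _ => 1].
Proof. by apply/permP=> x; rewrite !permE /shear_fun ffunE. Qed.

Lemma z_shear a : z a = shear [ffun u => (u == a)%:R].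
Proof.
apply/permP=> -[u v]; rewrite !permE /shear_fun /z_fun /= ffunE.
by case: ifP; rewrite ?addr0.
Qed.

Lemma expgz_z a (k : int) :
  expgz (z a) k = shear [ffun u => (u == a)%:R *~ k].
Proof.
rewrite z_shear; case: k => k; rewrite /= -?shearMn -?shearN; congr shear;
  by apply/ffunP=> u; rewrite !ffunE ?ffunMnE ?ffunE.
Qed.

(** Normal form for the elements of [P' p n], kept Boolean so that it defines a set of
    permutations. *)
Definition in_P n s :=
  [exists a, exists g, deg_lt n g && [forall x, s x == (x.1 + a, x.2 + g x.1)]].

Lemma in_PP n s :
  reflect (exists a g, deg_lt n g /\ forall x, s x = (x.1 + a, x.2 + g x.1))
          (in_P n s).
Proof.
apply: (iffP existsP) =>
  [[a /existsP[g /andP[gn /forallP sE]]]|[a [g [gn sE]]]].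
  by exists a, g; split=> // x; apply/eqP.
by exists a; apply/existsP; exists g; rewrite gn; apply/forallP=> x; rewrite sE.
Qed.

Lemma in_P_group n : group_set [set s | in_P n s].
Proof.
apply/group_setP; split=> [|s t]; rewrite !inE.
  apply/in_PP; exists 0, 0; split; first exact: deg_lt0.
  by case=> u v; rewrite perm1 ffunE !addr0.
move=> /in_PP[a [g [gn sE]]] /in_PP[b [h [hn tE]]]; apply/in_PP.
exists (a + b), (g + [ffun u => h (u + a)]); split.
  exact/deg_ltD/deg_lt_shift.
by move=> x; rewrite permM sE tE !ffunE /= !addrA.
Qed.

Hypothesis p_pr : prime p.

Lemma gamma_shear i : gamma p i = shear (bincoef p (p - i)).
Proof.
have ->: gamma p i =
  shear (\sum_(0 <= k < p) [ffun u => (u == k%:R)%:R *~ acoef (p - i) k]).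
  rewrite (big_morph shear shearD shear0); apply: eq_bigr => k _.
  exact: expgz_z.
congr shear; apply/ffunP=> u; rewrite sum_ffunE.
(* Only the factor of index [u] moves column [u], so a single exponent survives in the sum. *)
have [k ltkp ->] := Fp_nat p_pr u.
rewrite (bigD1_seq k) ?mem_index_iota ?iota_uniq //= big1_seq => [|j].
  by rewrite addr0 !ffunE eqxx val_Fp_nat // modn_small.
rewrite mem_index_iota => /and3P[neqjk _ ltjp].
rewrite ffunE -(inj_eq val_inj) /= !val_Fp_nat // !modn_small //.
by rewrite eq_sym (negPf neqjk) mul0rz.
Qed.

Lemma rho2X n x : (rho2 p ^+ n)%g x = (x.1 + n%:R, x.2).
Proof.
elim: n x => [|n IHn] [u v]; first by rewrite perm1 addr0.
by rewrite expgSr permM IHn permE /rho2_fun /= -addrA natr1.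
Qed.

(** Dividing this conjugate by [shear g] gives [shear (Delta g)], so a group containing [rho2] and
    [shear g] contains that shear too. *)
Lemma rho2_shear g : (rho2 p * shear g * (rho2 p)^-1)%g = shear [ffun u =>
  g (u + 1)].
Proof.
apply: (mulIg (rho2 p)); rewrite mulgKV; apply/permP=> x.
by rewrite !permM !permE /shear_fun /rho2_fun /= ffunE.
Qed.

Lemma mem_P' i s : (0 < i <= p)%N -> (s \in P' p i) = in_P i s.
Proof.
move=> hi; apply/idP/idP => [|/in_PP[a [g [gi sE]]]].
  suff /subsetP sub: P' p i \subset Group (in_P_group i) by move/sub;
    rewrite inE.
  rewrite gen_subG; apply/subsetP=> t; rewrite !inE => /orP[/orP[]|] /eqP ->;
    apply/in_PP.
  - exists 0, [ffun _ => 1]; split; first by case: i hi => // i _;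
    apply: deg_lt_cst.
    by move=> x; rewrite rho1_shear permE /shear_fun addr0.
  - exists 1, 0; split; first exact: deg_lt0.
    by move=> x; rewrite permE /rho2_fun ffunE addr0.
  exists 0, (bincoef p (p - i)); split; first exact: deg_lt_bincoef.
  by move=> x; rewrite gamma_shear permE /shear_fun addr0.
have r2P : rho2 p \in P' p i by rewrite mem_gen // !inE eqxx orbT.
(* The functions whose shears lie in the group are closed under sums and differences and include
   that of [gamma p i]; hence they include all those of degree less than [i]. *)
have shP : shear g \in P' p i.
  apply: (deg_lt_span (G := fun h => shear h \in P' p i) p_pr hi) gi =>
    [|h k hP kP|h hP|].
  - by rewrite shear0 group1.
  - by rewrite shearD groupM.
  - rewrite (_ : Delta h = [ffun u => h (u + 1)] - h).
      by rewrite shearD shearN -rho2_shear !(groupM, groupV).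
    by apply/ffunP=> u; rewrite !ffunE.
  by rewrite -gamma_shear mem_gen // !inE eqxx orbT.
rewrite (_ : s = shear g * rho2 p ^+ (a : nat))%g ?groupM ?groupX //.
apply/permP=> x; rewrite sE permM rho2X natr_Zp permE //.
Qed.

(** * Elements normalizing P'_i *)

Definition normalizing n s b c a h :=
  [/\ b != 0, a != 0, deg_lt n (Delta h) &
      forall x, s x = (b * x.1 + c, a * x.2 + h x.1)].

Lemma norm_P'P i s : (0 < i <= p)%N ->
  reflect (forall t, in_P i t -> in_P i (t ^ s)%g) (s \in 'N(P' p i)%g).
Proof.
move=> hi; apply: (iffP idP) => [sN t|sN].
  by rewrite -!(mem_P' _ hi) memJ_norm.
rewrite inE; apply/subsetP=> _ /imsetP[t tP ->].
by rewrite (mem_P' _ hi) sN // -(mem_P' _ hi).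
Qed.

Lemma normalizing_norm i s b c a h : (0 < i <= p)%N ->
  normalizing i s b c a h -> s \in 'N(P' p i)%g.
Proof.
move=> hi [b0 a0 hn sE]; apply/(norm_P'P _ hi) => t /in_PP[d [g [gi tE]]];
  apply/in_PP.
(* The vertical displacement caused by [t ^ s], as a function of the column before [s] is applied;
   the witness below composes it with the inverse of [u |-> b * u + c]. *)
pose k := [ffun u => a * g u] + [ffun u => h (u + d) - h u].
exists (b * d), [ffun u => k (b^-1 * u + - (b^-1 * c))]; split.
  by apply/deg_lt_affine/deg_ltD; [apply: deg_ltZ | apply: deg_lt_diff].
move=> x; rewrite -[x](permKV s); move: (s^-1%g x) => y.
rewrite -permM -conjgC permM sE tE sE !ffunE /=.
by congr (_, _); rewrite -?[b^-1 * _ + _]mulrBr ?addrK ?mulKf //; ring.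
Qed.

(** The relation [t * s = s * t ^ s], evaluated at points. *)
Lemma norm_act i s t : (0 < i <= p)%N -> s \in 'N(P' p i)%g -> in_P i t ->
  exists d g, deg_lt i g /\ forall x, s (t x) =
    ((s x).1 + d, (s x).2 + g (s x).1).
Proof.
move=> hi /(norm_P'P _ hi) sN /sN /in_PP[d [g [gi tE]]]; exists d, g;
  split=> // x.
by rewrite -tE -!permM conjgC.
Qed.

Lemma shear_in_P i g : deg_lt i g -> in_P i (shear g).
Proof.
move=> gi; apply/in_PP; exists 0, g; split=> // x.
by rewrite permE /shear_fun addr0.
Qed.

Lemma rho2_in_P i : in_P i (rho2 p).
Proof.
apply/in_PP; exists 1, 0; split; first exact: deg_lt0.
by move=> x; rewrite permE /rho2_fun ffunE addr0.
Qed.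

(* A shear fixing one point is mapped to a member of [P' p i] fixing a point,
   which is again a shear; those shears are transitive on every column. *)
Lemma norm_columns i s : (1 < i <= p)%N -> s \in 'N(P' p i)%g ->
  forall u v, (s (u, v)).1 = (s (u, 0)).1.
Proof.
move=> /andP[i1 ip] sN u; have hi : (0 < i <= p)%N by rewrite ltnW.
(* This function vanishes at [u - 1], so its shear has a fixed point and [d = 0] follows; it equals
   1 at [u], so the shear moves column [u] in unit steps. Being of degree 1, it requires [1 < i]. *)
have gi : deg_lt i [ffun w : 'F_p => w + (1 - u)].
  by case: i i1 {sN ip hi} => [|[|i]] // _; apply: deg_lt_id.
have [d [g [_ sE]]] := norm_act hi sN (shear_in_P gi).
have d0 : d = 0.
  have := congr1 fst (sE (u - 1, 0)); rewrite permE /shear_fun /= ffunE.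
  rewrite (_ : u - 1 + (1 - u) = 0) ?addr0; last by ring.
  by rewrite -[LHS]addr0 => /addrI.
elim/Fp_succ_ind=> [//|v <-]; have := congr1 fst (sE (u, v)).
by rewrite permE /shear_fun /= ffunE d0 addr0 subrKC.
Qed.

Lemma norm_normalizing i s : (1 < i <= p)%N -> s \in 'N(P' p i)%g ->
  exists b c a h, normalizing i s b c a h.
Proof.
move=> i1p sN; have cols := norm_columns i1p sN.
have hi : (0 < i <= p)%N by case/andP: i1p => /ltnW ->.
have [b [g [gi r2E]]] := norm_act hi sN (rho2_in_P i).
have [d [k [ki r1E]]] : exists d k, deg_lt i k /\ forall x, s (rho1 p x) =
  ((s x).1 + d, (s x).2 + k (s x).1).
  apply: norm_act => //; rewrite rho1_shear; apply: shear_in_P.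
  by case: (i) hi => // j _; apply: deg_lt_cst.
pose c := (s (0, 0)).1; pose h := [ffun u => (s (u, 0)).2].
have s1 u v : (s (u, v)).1 = b * u + c.
  rewrite cols; elim/Fp_succ_ind: u {v} => [|u IHu];
    first by rewrite mulr0 add0r.
  have := congr1 fst (r2E (u, 0)); rewrite permE /rho2_fun /= => ->.
  by rewrite IHu; ring.
have s2 u v : (s (u, v)).2 = k (b * u + c) * v + h u.
  elim/Fp_succ_ind: v => [|v IHv]; first by rewrite mulr0 add0r ffunE.
  have := congr1 snd (r1E (u, v)); rewrite permE /rho1_fun /= => ->.
  by rewrite IHv s1; ring.
have r2E' u v : k (b * (u + 1) + c) * v + h (u + 1) =
                k (b * u + c) * v + h u + g (b * u + c).
  have := congr1 snd (r2E (u, v)); rewrite permE /rho2_fun /=.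
  by rewrite !s2 s1.
(* Comparing [r2E'] at [v = 0] and [v = 1] shows that the slope is the same on all columns. *)
have kE u : k (b * u + c) = k c.
  elim/Fp_succ_ind: u => [|u <-]; first by rewrite mulr0 add0r.
  have := r2E' u 0; rewrite !mulr0 !add0r => E0.
  by have := r2E' u 1; rewrite !mulr1 E0 -addrA => /addIr.
exists b, c, (k c), h; split.
(* With [b = 0] the image of [s] would lie in column [c] and miss [(c + 1, 0)]. *)
- apply/eqP=> b0; have := s1 (s^-1%g (c + 1, 0)).1 (s^-1%g (c + 1, 0)).2.
  rewrite -surjective_pairing permKV b0 mul0r add0r /= => /eqP.
  by rewrite -subr_eq0 addrC addKr oner_eq0.
- apply/eqP=> k0; have E : s (0, 1) = s (0, 0).
    by rewrite [LHS]surjective_pairing [RHS]surjective_pairing !s1 !s2 kE k0 !mul0r.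
  by have /eqP := congr1 snd (perm_inj E); rewrite /= oner_eq0.
- have := deg_lt_affine b c gi; congr deg_lt; apply/ffunP=> u.
  by have := r2E' u 0; rewrite !mulr0 !add0r !ffunE => ->; ring.
by case=> u v /=; rewrite [LHS]surjective_pairing s1 s2 kE.
Qed.

(** * Dilations and the semidirect product *)

Lemma mem_dilations s : (s \in dilations p) <->
  exists b a : 'F_p, [/\ b != 0, a != 0 & forall x, s x = (b * x.1, a * x.2)].
Proof.
split=> [|[b [a [b0 a0 sE]]]].
  pose D := [set t : {perm point p} | [exists b : 'F_p, exists a : 'F_p,
    [&& b != 0, a != 0 & [forall x, t x == (b * x.1, a * x.2)]]]].
  have DP t : reflect (exists b a : 'F_p, [/\ b != 0, a != 0 &
      forall x, t x = (b * x.1, a * x.2)]) (t \in D).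
    rewrite inE; apply: (iffP existsP) => [[b /existsP[a]]|[b [a [b0 a0 tE]]]].
      by case/and3P=> b0 a0 /forallP tE; exists b, a; split=> // x; apply/eqP.
    by exists b; apply/existsP; exists a; rewrite b0 a0; apply/forallP=> x;
      rewrite tE.
  have Dgr : group_set D.
    apply/group_setP;
      split=> [|t t' /DP[b [a [b0 a0 tE]]] /DP[b' [a' [b0' a0' tE']]]].
      by apply/DP; exists 1, 1; rewrite !oner_neq0; split=> // -[u v];
        rewrite perm1 !mul1r.
    apply/DP; exists (b' * b), (a' * a); rewrite !mulf_neq0 //; split=> // x.
    by rewrite permM tE tE' /= !mulrA.
  move=> sD; apply/DP; move: s sD; apply/subsetP.
  rewrite (gen_subG _ (Group Dgr)); apply/subsetP=> t /setUP[] /imsetP[b _ ->];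
    apply/DP.
    exists (val b), 1; rewrite oner_neq0 -unitfE (valP b).
    by split=> // x; rewrite permE /bar_fun mul1r.
  exists 1, (val b); rewrite oner_neq0 -unitfE (valP b).
  by split=> // x; rewrite permE /tilde_fun mul1r.
have ub : b \is a GRing.unit by rewrite unitfE.
have ua : a \is a GRing.unit by rewrite unitfE.
rewrite (_ : s = bar (FinRing.unit _ ub) * tilde (FinRing.unit _ ua))%g.
  by rewrite groupM // mem_gen // inE imset_f ?orbT.
by apply/permP=> x; rewrite sE permM !permE.
Qed.

(** The condition linking [i] and [j] holds both for [j = i.+1] and for [i = j = p], so both
    semidirect cases are covered at once. *)
Lemma normalizer_sdprod i j : (1 < i <= p)%N -> (0 < j <= p)%N ->
    (forall g, deg_lt j g = deg_lt i (Delta g)) ->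
  (P' p j ><| dilations p)%g = 'N(P' p i)%g.
Proof.
move=> i1p hj ij; have hi : (0 < i <= p)%N by case/andP: i1p => /ltnW ->.
have dilN n s : (0 < n <= p)%N -> s \in dilations p -> s \in 'N(P' p n)%g.
  move=> hn /mem_dilations[b [a [b0 a0 sE]]].
  apply: (@normalizing_norm n s b 0 a 0) => //; split=> //.
    by rewrite -deg_ltS deg_lt0.
  by move=> x; rewrite sE ffunE !addr0.
rewrite sdprodE.
- apply/setP=> s; apply/mulsgP/idP=> [[t d]|sN].
    rewrite mem_P' // => /in_PP[c [g [gj tE]]] dD ->; apply: groupM;
      last exact: dilN.
    apply: (@normalizing_norm i t 1 c 1 g) => //; split;
      rewrite ?oner_neq0 -?ij //.
    by move=> x; rewrite tE !mul1r.
  have [b [c [a [h [b0 a0 hi' sE]]]]] := norm_normalizing i1p sN.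
  have [ub ua] : b \is a GRing.unit /\ a \is a GRing.unit by rewrite !unitfE.
  (* The diagonal linear part of [s]; what remains after removing it lies in [P' p j]. *)
  pose d := (bar (FinRing.unit _ ub) * tilde (FinRing.unit _ ua))%g.
  have dE x : d x = (b * x.1, a * x.2) by rewrite permM !permE.
  have dD : d \in dilations p by apply/mem_dilations; exists b, a.
  exists (s * d^-1)%g d => //; last by rewrite mulgKV.
  rewrite mem_P' //; apply/in_PP; exists (b^-1 * c), [ffun u => a^-1 * h u];
    split.
    by apply: deg_ltZ; rewrite ij.
  move=> x; apply: (@perm_inj _ d); rewrite -permM mulgKV sE dE ffunE /=.
  by rewrite !mulrDr !mulVKf.
- by apply/subsetP=> s; apply: dilN.
apply/trivgP/subsetP=> s /setIP[]; rewrite mem_P' // => /in_PP[c [g [_ tE]]].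
move=> /mem_dilations[b [a [b0 a0 sE]]]; rewrite inE; apply/eqP/permP=> -[u v].
(* Comparing the two forms of [s] at the origin and the two unit points forces both scalars to be
   1. *)
have st w := etrans (esym (sE w)) (tE w).
have c0 : c = 0 by have /= := congr1 fst (st (0, 0)); rewrite mulr0 add0r.
have g0 : g 0 = 0 by have /= := congr1 snd (st (0, 0)); rewrite mulr0 add0r.
have b1 : b = 1 by have /= := congr1 fst (st (1, 0)); rewrite c0 mulr1 addr0.
have a1 : a = 1 by have /= := congr1 snd (st (0, 1)); rewrite g0 mulr1 addr0.
by rewrite perm1 sE b1 a1 !mul1r.
Qed.

(** * The case i = 1: translations and affine maps *)

Lemma colv_inj : injective (@colv p).
Proof.
move=> [u v] [u' v'] E; have /= := congr1 (fun M : 'cV_2 => (M 0 0, M 1 0)) E.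
by rewrite !mxE.
Qed.

Lemma colv_surj (w : 'cV['F_p]_2) : colv (w 0 0, w 1 0) = w.
Proof.
apply/matrixP=> k l; rewrite ord1 mxE /=.
by case: k => -[|[|k]] //= hk; congr (w _ _); apply: val_inj.
Qed.

(** Degree less than 1 means constant, so [P' p 1] consists of the translations. *)
Lemma in_P1P s :
  reflect (exists w, forall x, colv (s x) = colv x + w) (in_P 1 s).
Proof.
apply: (iffP (in_PP 1 s)) => [[a [g [/eqP /Delta_cst g1 sE]]]|[w sE]].
  exists (colv (a, g 0)) => x; apply/matrixP=> k l; rewrite sE g1 !mxE /=.
  by case: ifP.
exists (w 0 0), [ffun _ => w 1 0]; split; first exact: deg_lt_cst.
move=> x; apply: colv_inj; rewrite sE -[w in LHS]colv_surj.
by apply/matrixP=> k l; rewrite !mxE /= ffunE; case: ifP.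
Qed.

Lemma AGL2P s :
  reflect (exists (A : {'GL_2['F_p]}) w,
             forall x, colv (s x) = GLval A *m colv x + w) (s \in AGL2 p).
Proof.
rewrite inE; apply: (iffP existsP) => [[A /existsP[c /forallP sE]]|[A [c sE]]].
  by exists A, c => x; apply/eqP.
by exists A; apply/existsP; exists c; apply/forallP=> x; apply/eqP.
Qed.

Lemma normalizer_translations : 'N(P' p 1)%g = AGL2 p.
Proof.
have h1 : (0 < 1 <= p)%N by rewrite /= prime_gt0.
apply/setP=> s; apply/idP/(AGL2P s) => [sN|[A [c sE]]]; last first.
  apply/(norm_P'P _ h1) => t /in_P1P[w tE]; apply/in_P1P.
  exists (GLval A *m w) => x; rewrite -[x](permKV s); move: (s^-1%g x) => y.
  by rewrite -permM -conjgC permM !sE tE mulmxDr addrAC.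
have tr t : in_P 1 t -> exists w, forall x, colv (s (t x)) = colv (s x) + w.
  move/(norm_P'P _ h1): sN => sN /sN /in_P1P[w tE].
  by exists w => x; rewrite -tE -!permM conjgC.
have [v1 r1E] : exists w, forall x, colv (s (rho1 p x)) = colv (s x) + w.
  by apply: tr; rewrite rho1_shear; apply/shear_in_P/deg_lt_cst.
have [v2 r2E] := tr _ (rho2_in_P 1).
have sE u v : colv (s (u, v)) = u *: v2 + v *: v1 + colv (s (0, 0)).
  elim/Fp_succ_ind: u => [|u IHu].
    elim/Fp_succ_ind: v => [|v IHv]; first by rewrite !scale0r !add0r.
    have := r1E (0, v); rewrite permE /rho1_fun /= => ->.
    by rewrite IHv scalerDl scale1r addrAC !addrA.
  have := r2E (u, v); rewrite permE /rho2_fun /= => ->.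
  by rewrite IHu scalerDl scale1r addrAC [u *: v2 + _ + v2]addrAC.
(* The column order is [v2], [v1] because [rho2] moves the first coordinate. *)
pose A : 'M['F_p]_2 := \matrix_(k, l) (if l == 0 then v2 k 0 else v1 k 0).
have AE x : A *m colv x = x.1 *: v2 + x.2 *: v1.
  apply/matrixP=> k l; rewrite ord1 !mxE big_ord_recl big_ord1 !mxE /=.
  by congr (_ + _); apply: mulrC.
have sA x : colv (s x) = A *m colv x + colv (s (0, 0)).
  by case: x => u v; rewrite AE sE.
have uA : A \in unitmx.
  (* A nonzero kernel vector of [A] would be a second point with the same image as the origin; the
     transpose is there because [det0P] yields row vectors. *)
  rewrite -unitmx_tr unitmxE unitfE; apply/det0P=> -[w w0 wA].
  have Aw : A *m w^T = 0 by rewrite -[A]trmxK -trmx_mul wA trmx0.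
  case/eqP: w0; apply: trmx_inj; rewrite trmx0 -[w^T]colv_surj.
  set x := (_, _); suff -> : x = (0, 0).
    by apply/matrixP=> k l; rewrite !mxE if_same.
  apply: (@perm_inj _ s); apply: colv_inj; rewrite sA.
  by rewrite colv_surj Aw add0r.
by exists (FinRing.unit _ uA), (colv (s (0, 0))).
Qed.

End Groups.

Theorem lemma6 (p i : nat) (p_pr : prime p) (hi : (1 <= i <= p)%N) :
  [/\ i = 1%N -> 'N(P' p i)%g = AGL2 p,
      (2 <= i <= p - 1)%N -> (P' p i.+1 ><| dilations p)%g = 'N(P' p i)%g
    & i = p -> (P' p p ><| dilations p)%g = 'N(P' p i)%g].
Proof.
split=> [->|/andP[i1 ip]|->]; first exact: normalizer_translations.
  have ltip : (i < p)%N by rewrite -(prednK (prime_gt0 p_pr)) ltnS -subn1.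
  by apply: normalizer_sdprod => [|||g]; rewrite ?i1 ?(ltnW ltip) ?deg_ltS.
apply: normalizer_sdprod => [|||g]; rewrite ?prime_gt1 ?prime_gt0 ?leqnn //.
(* Every function has degree less than p, so both sides of the condition are true. *)
by rewrite !deg_lt_p.
Qed.
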